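(* For every $n\ge1$ and every $X\in\mathfrak B^n$, $h^{\star}(n,X)\le 2^{H(n,X)}$.
   Context: $\mathfrak B^n=\{0,1\}^n$ is regarded as $\mathbb F_2^n$; vectors are indexed $X=[X_0,\dots,X_{n-1}]$ with indices modulo $n$. For a rule $X\in\mathfrak B^n$, the additive cellular automaton $\mathfrak A(n,X)$ has state set $\mathfrak B^n$ and transition map the linear operator $\hat X$, $(\hat X*s)_i=\bigoplus_{k=0}^{n-1}X_k s_{i+k\bmod n}$. A state $s$ is cyclic if $\hat X^t*s=s$ for some $t\ge1$; the height $h^{\star}(n,X)$ is the maximum over all states $s$ of the least $t\ge0$ such that $\hat X^t*s$ is cyclic. The discrete baker transformation $\mathfrak b:\mathfrak B^n\to\mathfrak B^n$ is defined by $(\mathfrak b*X)_i=\bigoplus_{j\in\{0,\dots,n-1\}:\ 2j\equiv i\ (\mathrm{mod}\ n)}X_j$ (an empty sum being $0$). The baker diagram of $\mathfrak B^n$ is the directed graph on $\mathfrak B^n$ with edges $(Y,\mathfrak b*Y)$; $H(n,X)$ is the distance from $X$ to the closest cyclic vertex in it, i.e. the least $m\ge0$ such that $\mathfrak b^t*(\mathfrak b^m*X)=\mathfrak b^m*X$ for some $t\ge1$. *)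

(* Defs.v *)
From HB Require Import structures.
From mathcomp Require Import all_boot all_order all_algebra.

Set Implicit Arguments.
Unset Strict Implicit.
Unset Printing Implicit Defensive.

Import GRing.Theory.

(* [fconnect f] is reachability in the graph with edges (x, f x), in zero or
   more steps; starting from [f x] forces a period t >= 1, see [cyclicP]. *)
Definition cyclic_vertex (T : finType) (f : T -> T) (x : T) : bool :=
  fconnect f (f x) x.

Lemma cyclicP (T : finType) (f : T -> T) (x : T) :
  reflect (exists2 t, 1 <= t & iter t f x = x) (cyclic_vertex f x).
Proof.
apply: (iffP idP) => [cx|[[//|t] _]].
  by exists (findex f (f x) x).+1; rewrite // iterSr iter_findex.
by rewrite iterSr /cyclic_vertex => {2}<-; exact: fconnect_iter.
Qed.

Lemma ex_cyclic_iter (T : finType) (f : T -> T) (x : T) :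
  exists m, cyclic_vertex f (iter m f x).
Proof.
have /trajectP[i lt_i def_x] := looping_order f x.
exists i; apply/cyclicP; exists (order f x - i); first by rewrite subn_gt0.
by rewrite -iterD subnK // ltnW.
Qed.

Definition dist_to_cycle (T : finType) (f : T -> T) (x : T) : nat :=
  ex_minn (ex_cyclic_iter f x).

Definition add_mod (n : nat) (i k : 'I_n) : 'I_n :=
  Ordinal (ltn_pmod (i + k) (leq_ltn_trans (leq0n i) (ltn_ord i))).

Local Open Scope ring_scope.

Definition ca_map (n : nat) (X s : 'rV['F_2]_n) : 'rV['F_2]_n :=
  \row_i \sum_(k < n) X 0 k * s 0 (add_mod i k).

Definition baker (n : nat) (X : 'rV['F_2]_n) : 'rV['F_2]_n :=
  \row_i \sum_(j < n | (2 * j == i %[mod n])%N) X 0 j.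

Definition ca_height (n : nat) (X : 'rV['F_2]_n) : nat :=
  (\max_(s : 'rV['F_2]_n) dist_to_cycle (ca_map X) s)%N.

Definition baker_dist (n : nat) (X : 'rV['F_2]_n) : nat :=
  dist_to_cycle (@baker n) X.

(* Main.v *)
(* Squaring is additive in characteristic 2, so the transition operator of
   [baker X] is the square of that of [X], and the operator of [b^m X] is the
   [2^m]-th power of that of [X]. If [b^(t+m) X = b^m X] with [t >= 1], then the
   [2^(t+m)]-th and [2^m]-th powers of the operator agree, so every state is
   cyclic after [2^m] steps. *)
Require Import Defs.
From HB Require Import structures.
From mathcomp Require Import all_boot all_order all_algebra.

Set Implicit Arguments.
Unset Strict Implicit.
Unset Printing Implicit Defensive.

Import GRing.Theory.

Local Open Scope ring_scope.

(** The off-diagonal terms at [(k, l)] and [(l, k)] are equal, so they cancel in pairs. *)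
Lemma sum_sym_pchar2 (R : nzRingType) (n : nat) (F : 'I_n -> 'I_n -> R) :
    2%N \in [pchar R] -> (forall k l, F k l = F l k) ->
  \sum_k \sum_l F k l = \sum_k F k k.
Proof.
move=> R2 Fsym.
have split_row k : \sum_l F k l =
    F k k + (\sum_(l < n | (l < k)%N) F k l + \sum_(l < n | (k < l)%N) F k l).
  rewrite (bigD1 k) //= (bigID (fun l : 'I_n => (l < k)%N)) /=.
  congr (_ + (_ + _)); apply: eq_bigl => l; rewrite -val_eqE /=.
    by case: ltngtP.
  by case: ltngtP.
rewrite (eq_bigr _ (fun k _ => split_row k)) !big_split /=.
rewrite [X in _ + (_ + X)](exchange_big_dep xpredT) //=.
rewrite [X in _ + (_ + X)](eq_bigr (fun l : 'I_n =>
  \sum_(k < n | (k < l)%N) F l k)); last by move=> l _; apply: eq_bigr.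
by rewrite addrr_pchar2 // addr0.
Qed.

Lemma mulrr_F2 (x : 'F_2) : x * x = x.
Proof. by apply/eqP; case: x => [[|[|]]]. Qed.

Lemma ca_map_baker (n : nat) (X s : 'rV['F_2]_n) :
  ca_map (baker X) s = ca_map X (ca_map X s).
Proof.
apply/rowP => i; rewrite !mxE.
(* Both sides equal the sum of [X_k s_(i+2k)]: on the right, the terms [X_k X_l s_(i+k+l)] are
   symmetric in [k] and [l], and [X_k^2 = X_k]. *)
transitivity (\sum_(k < n) X 0 k * s 0 (add_mod (add_mod i k) k)); last first.
  symmetry; under eq_bigr => k _ do rewrite mxE mulr_sumr.
  rewrite sum_sym_pchar2 ?pchar_Fp //.
    by apply: eq_bigr => k _; rewrite mulrA mulrr_F2.
  move=> k l; rewrite mulrCA; congr (_ * (_ * s 0 _)).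
  by apply/val_inj; rewrite /= !modnDml addnAC.
under eq_bigr => j _ do rewrite mxE mulr_suml.
rewrite (exchange_big_dep xpredT) //=; apply: eq_bigr => k _.
(* For fixed [k], only [j = 2k mod n] satisfies the congruence. *)
rewrite (big_pred1 (add_mod k k)) => [|j].
  by congr (_ * s 0 _); apply/val_inj; rewrite /= modnDmr modnDml addnA.
by rewrite /= mul2n -addnn (modn_small (ltn_ord j)) eq_sym.
Qed.

Lemma ca_map_iter_baker (n m : nat) (X s : 'rV['F_2]_n) :
  ca_map (iter m (@baker n) X) s = iter (2 ^ m) (ca_map X) s.
Proof.
elim: m s => [//|m IHm] s.
by rewrite iterS ca_map_baker !IHm -iterD addnn -mul2n expnS.
Qed.

Local Close Scope ring_scope.

Theorem theorem5 (n : nat) (n_ge1 : 1 <= n) (X : 'rV['F_2]_n) :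
  ca_height X <= 2 ^ baker_dist X.
Proof.
rewrite /baker_dist /dist_to_cycle; case: ex_minnP => m /cyclicP[t t_gt0 bX] _.
apply/bigmax_leqP => s _; rewrite /dist_to_cycle.
(* By minimality of [h], it suffices that the state after [2 ^ m] steps is cyclic. *)
case: ex_minnP => h _; apply; apply/cyclicP.
(* The gap between the two agreeing powers is a period, positive because [t >= 1]. *)
exists (2 ^ (t + m) - 2 ^ m).
  by rewrite subn_gt0 ltn_exp2l // -[X in X < _]add0n ltn_add2r.
rewrite -iterD subnK; last by rewrite leq_exp2l // leq_addl.
by rewrite -!ca_map_iter_baker iterD bX.
Qed.
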